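(* If $\mathbf{C}$ is a coreflective subcategory of $\mathbf{Top}$ with $\mathbf{C}\not\subseteq\mathrm{CH}(\mathbf{Con})$, then there exists a regular cardinal $\alpha$ such that $\mathrm{CH}(C(\alpha))\subseteq\mathbf{C}$.
   Context: $\mathbf{Top}$ is the category of topological spaces and continuous maps. All subcategories are full and isomorphism-closed, and every subcategory of $\mathbf{Top}$ is assumed to contain at least one space with at least two points. A subcategory of $\mathbf{Top}$ is coreflective in $\mathbf{Top}$ if and only if it is closed under topological sums (disjoint unions) and quotient spaces. $\mathrm{CH}(\mathbf{B})$ (or $\mathrm{CH}(B)$ for a single space $B$) denotes the coreflective hull in $\mathbf{Top}$, the smallest coreflective subcategory of $\mathbf{Top}$ containing $\mathbf{B}$; it consists of all quotients of topological sums of spaces from $\mathbf{B}$. $\mathbf{Con}$ is the class of all connected spaces; $\mathrm{CH}(\mathbf{Con})$ consists precisely of the topological sums of connected spaces. Ordinals are identified with the sets of their predecessors and cardinals with initial ordinals. For an infinite cardinal $\alpha$, $C(\alpha)$ is the space on the set $\alpha\cup\{\alpha\}$ in which each $\beta\in\alpha$ is isolated and the sets $B_\beta=\{\xi\in\alpha\cup\{\alpha\}:\xi\ge\beta\}$, $\beta<\alpha$, form a local base at $\alpha$. Regular cardinals are understood to be infinite. *)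

(* Defs.v *)
From HB Require Import structures.
From mathcomp Require Import all_boot all_order.
From mathcomp Require Import boolp classical_sets functions cardinality wochoice.
From mathcomp Require Import topology.

Set Implicit Arguments.
Unset Strict Implicit.
Unset Printing Implicit Defensive.

Import Order.TTheory.
Local Open Scope classical_set_scope.
Local Open Scope card_scope.
Local Open Scope order_scope.

Definition homeomorphic (X Y : topologicalType) : Prop :=
  exists (f : X -> Y) (g : Y -> X),
    [/\ continuous f, continuous g, cancel f g & cancel g f].

(* A class of spaces stands for the full subcategory of Top that it spans. *)
Definition space_class := topologicalType -> Prop.

Definition subclass (B C : space_class) : Prop := forall X, B X -> C X.

Record subcategory (C : space_class) : Prop := Subcategory {
  subcategory_iso : forall X Y, homeomorphic X Y -> C X -> C Y;
  subcategory_two_points : exists X, C X /\ exists x y : X, x <> y }.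

(* (cX, c) is a coreflection of X in C: a terminal object of the comma
   category of C over X. *)
Definition coreflection (C : space_class) (X cX : topologicalType)
    (c : cX -> X) : Prop :=
  [/\ C cX, continuous c
    & forall (A : topologicalType) (f : A -> X), C A -> continuous f ->
        exists! g : A -> cX, continuous g /\ c \o g = f].

Definition coreflective (C : space_class) : Prop :=
  subcategory C /\
  forall X : topologicalType,
    exists (cX : topologicalType) (c : cX -> X), coreflection C c.

(* The smallest coreflective subcategory containing B, as an intersection. *)
Definition CH (B : space_class) : space_class :=
  fun X => forall D, coreflective D -> subclass B D -> D X.

Definition CH1 (B : topologicalType) : space_class :=
  CH (fun X => homeomorphic X B).

Definition Con : space_class := fun X => connected [set: X].

(* Infinite initial ordinals, as well-ordered types rather than von Neumann
   sets: an element a plays the role of the ordinal {x | x < a}. *)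
Record infinite_cardinal := InfiniteCardinal {
  ic_disp : Order.disp_t;
  ic_car :> orderType ic_disp;
  ic_well_order : well_order (<=%O : rel ic_car);
  ic_initial : forall a : ic_car, ~ ([set: ic_car] #<= [set x | x < a]);
  ic_infinite : infinite_set [set: ic_car] }.

Definition cofinal (alpha : infinite_cardinal) (S : set alpha) : Prop :=
  forall a : alpha, exists2 s, S s & a <= s.

Definition regular (alpha : infinite_cardinal) : Prop :=
  forall S : set alpha, cofinal S -> S #= [set: alpha].

(* The set alpha U {alpha}, with None for the point alpha. *)
Definition Cspace (alpha : infinite_cardinal) : Type := option alpha.

HB.instance Definition _ (alpha : infinite_cardinal) :=
  Choice.copy (Cspace alpha) (option alpha).

Section Cspace_topology.
Variable alpha : infinite_cardinal.

Definition Cspace_tail (b : alpha) : set (Cspace alpha) :=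
  [set xi | if xi is Some x then b <= x else True].

Definition Cspace_open (U : set (Cspace alpha)) : Prop :=
  U None -> exists b, Cspace_tail b `<=` U.

Lemma Cspace_openT : Cspace_open setT.
Proof.
move=> _; have /set0P[b _] : [set: alpha] != set0.
  by apply/eqP => E; apply: (@ic_infinite alpha); rewrite E.
by exists b.
Qed.

Lemma Cspace_openI (U V : set (Cspace alpha)) :
  Cspace_open U -> Cspace_open V -> Cspace_open (U `&` V).
Proof.
move=> oU oV [/oU[b bU] /oV[c cV]]; exists (Order.max b c) => -[x|] /=.
  by rewrite ge_max => /andP[bx cx]; split; [apply: bU|apply: cV].
by move=> _; split; [apply: bU|apply: cV].
Qed.

Lemma Cspace_open_bigU (I : Type) (f : I -> set (Cspace alpha)) :
  (forall i, Cspace_open (f i)) -> Cspace_open (\bigcup_i f i).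
Proof.
by move=> of_ [i _ /(of_ i)[b bf]]; exists b => x /bf fx; exists i.
Qed.

HB.instance Definition _ := isOpenTopological.Build (Cspace alpha)
  Cspace_openT Cspace_openI Cspace_open_bigU.

End Cspace_topology.

(* Main.v *)
Require Import Defs.
From mathcomp Require Import all_boot all_order.
From mathcomp Require Import boolp classical_sets topology.
From HB Require Import structures.
From mathcomp Require Import functions cardinality wochoice.

Set Implicit Arguments.
Unset Strict Implicit.
Unset Printing Implicit Defensive.

Import Order.TTheory.
Local Open Scope order_scope.
Local Open Scope card_scope.
Local Open Scope classical_set_scope.

(* Take X in C outside CH(Con). If every intersection of clopen sets of X were
   open, the quasi-components of X would be open and connected, and X would be
   their sum. So some family of clopen sets has a non-open intersection; index
   one by the least possible order type alpha. Minimality makes alpha an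
   initial ordinal, infinite because finite intersections are open, and
   regular because a cofinal subset indexes the partial intersections. Sending
   x to the first index whose set misses x (or to the point alpha) is a
   continuous map X -> C(alpha). If W contains the point alpha and its
   complement is unbounded, pushing each index up into that complement gives a
   continuous map under which the preimage of W is the non-open intersection.
   Hence C(alpha) carries the final topology for maps from C, so it is in C. *)

(** * Well-ordered types and their initial segments *)

Definition wo_sort (T : choiceType) (R : rel T) (woR : well_order R) : Type :=
  T.

Section WellOrderType.
Variables (T : choiceType) (R : rel T) (woR : well_order R).

HB.instance Definition _ := Choice.copy (wo_sort woR) T.

Let R_total : total R.
Proof.
have wo : wo_chain R predT by move=> A _; apply: woR.
by move=> x y; apply: (wo_chainW wo).
Qed.

Let R_refl : reflexive R.
Proof. by move=> x; have := R_total x x; rewrite orbb. Qed.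

Let R_anti : antisymmetric R.
Proof.
have wo : wo_chain R predT by move=> A _; apply: woR.
by move=> x y; apply: (wo_chain_antisymmetric wo).
Qed.

Let R_trans : transitive R.
Proof.
move=> y x z xy yz.
(* Take the least of the three points: if it is not [x], antisymmetry identifies two of them. *)
have [|m [[mA mlb] _]] := woR (A := [pred t | [|| t == x, t == y | t == z]]).
  by exists x; rewrite inE eqxx.
have mx : R m x by apply: mlb; rewrite !inE eqxx.
have my : R m y by apply: mlb; rewrite !inE eqxx orbT.
have mz : R m z by apply: mlb; rewrite !inE eqxx !orbT.
move: mA; rewrite inE => /or3P[] /eqP mE; first by rewrite -mE.
  by have -> : x = y by apply: R_anti; rewrite xy -mE mx.
by have <- : y = z by apply: R_anti; rewrite yz -mE my.
Qed.

HB.instance Definition _ := Order.Le_isPOrder.Build (Order.Disp tt tt)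
  (wo_sort woR) R_refl R_anti R_trans.
HB.instance Definition _ := Order.POrder_isTotal.Build (Order.Disp tt tt)
  (wo_sort woR) R_total.

Lemma wo_sort_well_order : well_order (<=%O : rel (wo_sort woR)).
Proof. exact: woR. Qed.

End WellOrderType.

Lemma well_order_sub (T : choiceType) (R : rel T) (P : pred T) :
  well_order R -> well_order (fun x y : {x : T | P x} => R (val x) (val y)).
Proof.
move=> woR A [a Aa].
have inA x (Px : P x) : (x \in [pred x | `[< exists Px, A (exist P x Px) >]])
    = ((exist P x Px : {x | P x}) \in A).
  rewrite inE; apply/asboolP/idP => [[Px'] |AP]; last by exists Px.
  by rewrite (bool_irrelevance Px' Px).
have [|m [[mA mlb] muniq]] :=
  woR [pred x | `[< exists Px : P x, A (exist P x Px) >]].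
  by case: a Aa => a Pa Aa; exists a; rewrite inA.
move: (mA); rewrite inE => -[Pm Am].
exists (exist P m Pm); split; first split=> //.
  by move=> [y Py] Ay /=; apply: mlb; rewrite inA.
move=> [y Py] [Ay ylb]; apply: val_inj => /=; apply: muniq; split.
  by rewrite inA.
move=> z; rewrite inE => -[Pz Az]; exact: (ylb (exist P z Pz)).
Qed.

Lemma well_order_least d (T : orderType d) (x0 : T) :
  well_order (<=%O : rel T) ->
  exists least : set T -> T, forall A : set T, A !=set0 ->
    A (least A) /\ forall x, A x -> least A <= x.
Proof.
move=> woT.
suff /choice[l lP] : forall A : set T, exists m, A !=set0 ->
    A m /\ forall x, A x -> m <= x by exists l.
(* The empty set receives the filler [x0], so that [least] is total. *)
move=> A; have [[a Aa]|A0] := pselect (A !=set0); last by exists x0.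
have [|m [[mA mlb] _]] := woT [pred x | `[< A x >]].
  by exists a; rewrite inE.
exists m => _; split; first by move: mA; rewrite inE.
by move=> x Ax; apply: mlb; rewrite inE.
Qed.

(* The Mostowski collapse of [S] is an initial segment, either proper or not. *)
Lemma well_order_collapse d (T : orderType d) (S : set T) :
  well_order (<=%O : rel T) ->
  [set: T] #<= S \/ exists b : T, S #<= [set x | x < b].
Proof.
move=> woT.
have [->|/set0P[x0 _]] := eqVneq S set0.
  have [[b _]|T0] := pselect ([set: T] !=set0); first by right; exists b.
  left; suff -> : [set: T] = set0 by [].
  by apply/eqP; apply: contrapT => /negP/set0P.
have [least leastP] := well_order_least x0 woT.
have wf : well_founded (fun x y : T => x < y).
  move=> x; apply: contrapT => nx.
  have [] := leastP [set x | ~ Acc (fun x y : T => x < y) x]; first by exists x.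
  move=> nl lmin; apply: nl; constructor => y yl.
  by apply: contrapT => /lmin; rewrite leNgt yl.
pose F x (f : forall y, y < x -> T) : T :=
  least [set a | ~ exists y (yx : y < x), S y /\ f y yx = a].
pose g := Fix wf (fun _ => T) F.
pose below x := [set a | exists2 y, y < x & S y /\ g y = a].
have gE x : g x = least (~` below x).
  rewrite /g Fix_eq /F; last first.
    move=> y f1 f2 f12; congr least; apply/seteqP.
    by split=> a /= na [z [zy [Sz fz]]]; apply: na; exists z, zy;
      rewrite ?f12 // -f12.
  congr least; apply/seteqP.
  by split=> a /= na; [move=> [y yx Sy]|move=> [y [yx Sy]]]; apply: na;
    [exists y, yx|exists y].
(* Earlier values do not exceed their arguments, so [x] itself is still free; hence [least] is only
   evaluated on nonempty sets. *)
have g_le x : g x <= x.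
  elim/(well_founded_ind wf): x => x IH; rewrite gE.
  have xx : (~` below x) x.
    by move=> [y yx [Sy gy]]; have := IH y yx; rewrite gy leNgt yx.
  by have [|_ ->] := leastP (~` below x); first by exists x.
have gP x : ~ below x (g x) /\ forall a, a < g x -> below x a.
  have [|nb lb] := leastP (~` below x).
    exists x => -[y yx [Sy gy]]; have := g_le y; by rewrite gy leNgt yx.
  rewrite gE; split=> // a al; apply: contrapT => /lb; by rewrite leNgt al.
have g_inj : {in S &, injective g}.
  move=> x y; rewrite !inE => Sx Sy gxy.
  have [xy|yx|//] := ltgtP x y.
    by have [+ _] := gP y; case; exists x.
  by have [+ _] := gP x; case; exists y.
(* By [gP] the image of [S] under [g] is closed downwards: it is all of [T], or it lies below any
   point [b] that it misses. *)
have [gS|] := pselect ([set: T] `<=` g @` S).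
  by left; apply: card_le_trans (subset_card_le gS) (card_image_le g S).
move=> /existsNP[b /not_implyP[_ ngb]]; right; exists b.
rewrite -(card_le_eql (inj_card_eq g_inj)); apply: subset_card_le.
move=> _ [s Ss <-] /=; rewrite ltNge le_eqVlt; apply/negP => /orP[/eqP bE|bg].
  by apply: ngb; exists s.
by have [_ /(_ b bg)[y _ [Sy gy]]] := gP s; apply: ngb; exists y.
Qed.

(** * Families of clopen sets with a non-open intersection *)

Section BadFamily.
Variable X : topologicalType.

Definition bad_family (I : Type) (J : set I) : Prop :=
  exists2 U : I -> set X,
    forall i, clopen (U i) & ~ open (\bigcap_(i in J) U i).

(** Families can be moved along injections, so badness depends only on the cardinality of the index
    set and survives enlarging it. *)
Lemma bad_family_card_le (I K : Type) (J : set I) (L : set K) :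
  J #<= L -> bad_family J -> bad_family L.
Proof.
move=> /card_leP[f] [U Uc nU].
have f_inj : injective f by move=> x y; apply: inj; rewrite inE.
(* Over the image of [f] the fibre is one point and [V] returns its member of [U]; elsewhere the
   intersection is empty-indexed, hence [setT]. *)
pose V k := \bigcap_(j in [set j : J | val (f j) = k]) U (val j).
have Vf j : V (val (f j)) = U (val j).
  rewrite /V (_ : [set _ | _] = [set j]) ?bigcap_set1 //.
  by apply/seteqP; split=> [i /val_inj/f_inj|_ ->].
exists V => [k|].
  have [[j <-]|nk] := pselect (exists j, val (f j) = k); first by rewrite Vf.
  suff -> : V k = setT by exact: clopenT.
  by apply/seteqP; split=> // x _ j /= jk; case: nk; exists j.
suff <- : \bigcap_(j in J) U j = \bigcap_(k in L) V k by [].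
apply/seteqP; split=> x Ux.
  move=> k _ j /= _; apply: Ux; exact: set_valP.
move=> j Jj; pose j' : J := SigSub (mem_set Jj).
by rewrite -[j]/(val j') -Vf; apply: Ux; exact: set_valP.
Qed.

Lemma bad_family_subset (I : Type) (J L : set I) :
  J `<=` L -> bad_family J -> bad_family L.
Proof. by move=> /subset_card_le; apply: bad_family_card_le. Qed.

Lemma bad_family_infinite (I : choiceType) (J : set I) :
  bad_family J -> infinite_set J.
Proof.
move=> [U Uc nU] Jfin; apply: nU; rewrite -[X in open X]setCK openC setC_bigcap.
by apply: closed_bigcup => // i _; rewrite -openC setCK; case: (Uc i).
Qed.

Lemma bad_family_cardinal (I : choiceType) (J : set I) :
  bad_family J ->
  exists alpha : infinite_cardinal,
    bad_family [set: alpha] /\ forall a : alpha, ~ bad_family [set x | x < a].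
Proof.
move=> badJ.
have [R woR] := well_ordering_principle I.
pose T := wo_sort woR.
have [i0 _] : J !=set0.
  apply/set0P/eqP => J0; apply: (bad_family_infinite badJ); rewrite J0.
  exact: finite_set0.
have [least leastP] := well_order_least (i0 : T) (@wo_sort_well_order _ _ woR).
(* [P] is the shortest bad proper initial segment of [T] if there is one, and all of [T]
   otherwise. *)
have [P badP minP] : exists2 P : pred T, bad_family [set` P]
    & forall a : T, P a -> ~ bad_family [set x : T | P x /\ x < a].
  pose A := [set a : T | bad_family [set x : T | x < a]].
  have [A0|A0] := pselect (A !=set0).
    have [lbad lmin] := leastP A A0; exists (fun x => x < least A) => // a al.
    move=> badP; have /lmin : A a.
      by apply: bad_family_subset badP => x [].
    by rewrite leNgt al.
  exists predT; first by apply: bad_family_subset badJ.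
  move=> a _ bada; apply: A0; exists a.
  by apply: bad_family_subset bada => x [].
have woP := @well_order_sub _ _ P (@wo_sort_well_order _ _ woR).
pose S := wo_sort woP.
have badS : bad_family [set: S].
  apply: bad_family_card_le badP.
  apply: card_le_trans (card_image_le (val : {x : T | P x} -> T) _).
  by apply: subset_card_le => x Px; exists (exist P x Px).
have nbad (a : S) : ~ bad_family [set x : S | x < a].
  move=> bada; apply: (minP (val a) (valP a)).
  apply: bad_family_card_le bada.
  rewrite -(@card_le_eql _ _ _ ((val : {x : T | P x} -> T) @` [set x : S | x < a])).
    apply: subset_card_le => _ [x xa <-]; split; first exact: valP.
    by move: xa => /=; rewrite (ltNge x) (@ltNge _ T).
  by apply: inj_card_eq => x y _ _; apply: val_inj.
(* An injection into a proper segment would carry badness down to it, against minimality. *)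
have init (a : S) : ~ ([set: S] #<= [set x | x < a]).
  by move=> le; apply: (nbad a); apply: bad_family_card_le badS.
exists (InfiniteCardinal (@wo_sort_well_order _ _ woP) init
  (bad_family_infinite badS)).
by split.
Qed.

End BadFamily.

(** * Coreflective classes and final topologies *)

Lemma coreflective_inhabited (C : space_class) :
  coreflective C -> exists A : topologicalType, C A /\ exists a : A, True.
Proof. by case=> -[_ [A [CA [a _]]]] _; exists A; split=> //; exists a. Qed.

(* Applied to the coreflection of X: constant maps make it bijective. *)
Lemma coreflective_final (C : space_class) (X : topologicalType) :
  coreflective C ->
  (forall U : set X,
    (forall (A : topologicalType) (f : A -> X), C A -> continuous f ->
      open (f @^-1` U)) -> open U) ->
  C X.
Proof.
move=> hC finalX; have [A [CA [a _]]] := coreflective_inhabited hC.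
have [sC corC] := hC; have [cX [c [CcX ccont cuniv]]] := corC X.
have c_inj : injective c.
  move=> u v cuv.
  have [|h [_ huniq]] := cuniv A (fun=> c u) CA; first exact: cst_continuous.
  have hu : h = fun=> u.
    by apply: huniq; split; first exact: cst_continuous.
  have hv : h = fun=> v.
    by apply: huniq; split; [exact: cst_continuous|rewrite cuv].
  by rewrite -[u]/((fun=> u) a) -hu hv.
have c_surj x : exists u, c u = x.
  have [|h [[_ hx] _]] := cuniv A (fun=> x) CA; first exact: cst_continuous.
  by exists (h a); rewrite -[LHS]/((c \o h) a) hx.
have [c' c'K] := choice c_surj.
apply: (subcategory_iso sC) CcX; exists c, c'; split=> //; last first.
  by move=> u; apply: c_inj; rewrite c'K.
apply/continuousP => W oW; apply: finalX => B f CB fcont.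
have [h [[hcont hf] _]] := cuniv B f CB fcont.
(* The lift [h] of [f] equals [c' \o f] because [c] is injective, so the finality test on [X]
   reduces to continuity of [h]. *)
suff -> : f @^-1` (c' @^-1` W) = h @^-1` W by move/continuousP: hcont; apply.
apply/seteqP; split=> b; rewrite /preimage /= -hf /=;
  by have -> : c' (c (h b)) = h b by apply: c_inj; rewrite c'K.
Qed.

(** * Quasi-components and sums of connected spaces *)

Section QuasiComponent.
Variable X : topologicalType.

Definition quasi_component (x : X) : set X :=
  \bigcap_(A in [set A : set X | clopen A /\ A x]) A.

Lemma quasi_component_refl x : quasi_component x x.
Proof. by move=> A []. Qed.

Definition quasi_retract (x y : X) : X :=
  if y \in quasi_component x then y else x.

Lemma quasi_retract_id x y :
  quasi_component x y -> quasi_retract x y = y.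
Proof. by rewrite /quasi_retract => /mem_set ->. Qed.

Lemma quasi_retract_in x y : quasi_component x (quasi_retract x y).
Proof.
rewrite /quasi_retract; case: ifPn => [/set_mem //|_].
exact: quasi_component_refl.
Qed.

(* In this topology the points outside the quasi-component are
   indistinguishable from [x]: it replaces the subspace topology. *)
Lemma connected_quasi_retract (x : X) : open (quasi_component x) ->
  Con (initial_topology (quasi_retract x)).
Proof.
set Q := quasi_component x; set r := quasi_retract x => oQ.
move=> B [b0 Bb0] [_ [O oO <-]]; rewrite setTI => BO [C].
rewrite -openC => -[O' oO' CO']; rewrite setTI => BC; subst C; subst B.
have Qc : closed Q by apply: closed_bigI => A [[]].
have rO y : Q y -> O y <-> ~ O' y.
  move=> Qy; have ry : r y = y by exact: quasi_retract_id.
  have := congr1 (fun Z : set X => Z y) CO'; rewrite /preimage /= ry => ->.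
  by split=> [Oy|/contrapT] //; apply.
(* [O] and [O'] are complementary on the clopen set [Q], so both traces are clopen in [X]; the one
   containing [x] must contain all of [Q]. *)
have clO : clopen (Q `&` O).
  split; first exact: openI.
  suff -> : Q `&` O = Q `&` ~` O'.
    by apply: closedI => //; rewrite -openC setCK.
  by apply/seteqP; split=> y [Qy /(rO y Qy)].
have clO' : clopen (Q `&` O').
  split; first exact: openI.
  suff -> : Q `&` O' = Q `&` ~` O.
    by apply: closedI => //; rewrite -openC setCK.
  apply/seteqP; split=> y [Qy]; first by move=> O'y; split=> // /(rO y Qy).
  by move=> nO; split=> //; apply: contrapT => /(rO y Qy).
have Qx : Q x by exact: quasi_component_refl.
have rQ y : Q (r y) by exact: quasi_retract_in.
have [Ox|nOx] := pselect (O x).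
  by apply/seteqP; split=> // y _; have [] := rQ y (Q `&` O).
have O'x : O' x by apply: contrapT => /(rO x Qx).
have [//|_] := rQ b0 (Q `&` O'); by have /(rO _ (rQ b0)) := Bb0.
Qed.

End QuasiComponent.

(** The index set [set X] captures every family of clopen sets, so quasi-components are open; the
    maps [quasi_retract x] from connected spaces then detect the open sets of [X]. *)
Lemma CH_Con_clopen (X : topologicalType) :
  ~ bad_family X [set: set X] -> CH Con X.
Proof.
move=> nbad D hD ConD.
have clo (F : set (set X)) : F `<=` clopen -> open (\bigcap_(A in F) A).
  move=> Fc; apply: contrapT => nF; apply: nbad.
  apply: (bad_family_subset (@subsetT _ F)).
  (* All members must be clopen, also those indexed outside [F]; [setT] fills in there. *)
  exists (fun A => if A \in F then A else setT) => [A|].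
    by case: ifPn => [/set_mem/Fc //|_]; exact: clopenT.
  suff -> : \bigcap_(A in F) (if A \in F then A else setT) =
    \bigcap_(A in F) A by [].
  by apply: eq_bigcapr => A /mem_set ->.
apply: coreflective_final hD _ => U Ufinal.
have oQ (x : X) : open (quasi_component x).
  by apply: (clo [set A : set X | clopen A /\ A x]) => A [].
rewrite openE => x Ux; rewrite /interior nbhsE /=.
have [O oO OU] : open
    (quasi_retract x @^-1` U : set (initial_topology (quasi_retract x))).
  apply: Ufinal; last exact: initial_continuous.
  exact/ConD/connected_quasi_retract.
have rU y : quasi_component x y -> O y <-> U y.
  move=> Qy; have := congr1 (fun Z : set X => Z y) OU.
  by rewrite /preimage /= quasi_retract_id // => ->.
have Qx : quasi_component x x by exact: quasi_component_refl.
exists (O `&` quasi_component x); last by move=> y [Oy Qy]; apply/(rU y Qy).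
by split; [exact: openI|split=> //; apply/(rU x Qx)].
Qed.

(** * From a minimal bad family to regularity and to [Cspace alpha] *)

Section MinimalBadFamily.
Variables (X : topologicalType) (alpha : infinite_cardinal).
Hypothesis bad_alpha : bad_family X [set: alpha].
Hypothesis good_below : forall a : alpha, ~ bad_family X [set x | x < a].

Let alpha_inhabited : exists t : alpha, True.
Proof.
apply: contrapT => n0; apply: (@ic_infinite alpha).
suff -> : [set: alpha] = set0 by exact: finite_set0.
by apply/seteqP; split=> // x _; apply: n0; exists x.
Qed.

(** Closedness is automatic; openness is what minimality of [alpha] provides. *)
Let clopen_below (U : alpha -> set X) (a : alpha) :
  (forall i, clopen (U i)) -> clopen (\bigcap_(i in [set x | x < a]) U i).
Proof.
move=> Uc; split; last by apply: closed_bigI => i _; case: (Uc i).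
by apply: contrapT => nU; apply: (@good_below a); exists U.
Qed.

Lemma minimal_bad_family_regular : regular alpha.
Proof.
move=> S Scof; apply/card_eqPle; split; first exact: card_leT.
have [//|[b Sb]] := well_order_collapse S (@ic_well_order alpha).
case: (@good_below b); apply: (bad_family_card_le Sb).
have [U Uc nU] := bad_alpha.
(* The factor [U s] includes the index [s] itself, since cofinality only gives [i <= s]. *)
exists (fun s => \bigcap_(i in [set x | x < s]) U i `&` U s) => [s|].
  by apply: clopenI => //; exact: clopen_below.
suff <- : \bigcap_(i in [set: alpha]) U i =
  \bigcap_(s in S) (\bigcap_(i in [set x | x < s]) U i `&` U s) by [].
apply/seteqP; split=> x Ux.
  by move=> s _; split=> [i _|]; exact: Ux.
move=> i _; have [s Ss] := Scof i; have [Us1 Us2] := Ux s Ss.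
by rewrite le_eqVlt => /orP[/eqP ->|/Us1].
Qed.

Lemma minimal_bad_family_Cspace (C : space_class) :
  coreflective C -> C X -> C (Cspace alpha).
Proof.
move=> hC CX; apply: coreflective_final hC _ => W Wfinal.
change (Cspace_open W) => WNone.
apply: contrapT => nW.
(* [W] contains the point [None] but no tail, so points outside [W] occur beyond every [t]. *)
have /choice[h hP] : forall t : alpha, exists s, t <= s /\ ~ W (Some s).
  move=> t; apply: contrapT => nt; apply: nW; exists t => -[s|] //= ts.
  by apply: contrapT => ns; apply: nt; exists s.
have [U Uc nU] := bad_alpha; have [t0 _] := alpha_inhabited.
have [least leastP] := well_order_least t0 (@ic_well_order alpha).
pose rank x := least [set t | ~ U t x].
pose f x : Cspace alpha :=
  if pselect (forall t, U t x) then None else Some (h (rank x)).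
have rankP x : ~ (forall t, U t x) ->
    ~ U (rank x) x /\ forall t, t < rank x -> U t x.
  move=> /existsNP nx; have [nr rmin] := leastP [set t | ~ U t x] nx.
  split=> // t tr; apply: contrapT => /rmin; by rewrite leNgt tr.
pose V a := \bigcap_(i in [set x | x < a]) U i.
have fcont : continuous f.
  apply/continuousP => O.
  change (Cspace_open O -> open (f @^-1` O)) => oO.
  (* Off the total intersection, [V t] minus [U t] is the fibre of [rank] over [t]. If a tail from
     [b] lies in [O], then [f] maps [V b] into it because [t <= h t]; if [O] misses [None], the
     first union is empty. *)
  suff -> : f @^-1` O = \bigcup_(b in [set b | Cspace_tail b `<=` O]) V b
     `|` \bigcup_(t in [set t | O (Some (h t))]) (V t `&` ~` U t).
    apply: openU; apply: bigcup_open => t _; first by case: (clopen_below t Uc).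
    by apply: openI; [case: (clopen_below t Uc)|rewrite openC; case: (Uc t)].
  apply/seteqP; split=> x.
    rewrite /preimage /= /f; case: pselect => [Ux|nUx] Ofx.
      by left; have [b bO] := oO Ofx; exists b => // t _; exact: Ux.
    have [nr rmin] := rankP x nUx.
    by right; exists (rank x) => //; split.
  rewrite /preimage /= /f => -[[b bO Vbx]|[t Ot [Vtx nUtx]]].
    case: pselect => [Ux|nUx]; first exact: bO.
    apply: bO => /=; apply: le_trans (proj1 (hP _)).
    rewrite leNgt; apply/negP => rb; have [nr _] := rankP x nUx.
    by apply: nr; exact: Vbx.
  case: pselect => [Ux|nUx]; first by case: nUtx.
  suff -> : rank x = t by [].
  have [nr rmin] := rankP x nUx; apply: le_anti.
  rewrite !leNgt; apply/andP; split; apply/negP.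
    by move=> /rmin.
  by move=> rt; apply: nr; exact: Vtx.
(* As [h] avoids [W], only points of the total intersection are sent into [W]. *)
apply: nU; suff -> : \bigcap_(t in [set: alpha]) U t = f @^-1` W.
  exact: Wfinal.
apply/seteqP; split=> x; rewrite /preimage /= /f.
  by move=> Ux; case: pselect => // -[t]; exact: Ux.
by case: pselect => [Ux _ t _ //|nUx] Wx; case: (hP (rank x)).
Qed.

End MinimalBadFamily.

Theorem proposition6p10 (C : space_class) (hC : coreflective C)
    (hCon : ~ subclass C (CH Con)) :
  exists alpha : infinite_cardinal,
    regular alpha /\ subclass (CH1 (Cspace alpha)) C.
Proof.
have [X [CX nX]] : exists X, C X /\ ~ CH Con X.
  by have /existsNP[X /not_implyP] := hCon; exists X.
have badX : bad_family X [set: set X].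
  by apply: contrapT => /CH_Con_clopen.
have [alpha [bad_alpha good_below]] := bad_family_cardinal badX.
exists alpha; split; first exact: minimal_bad_family_regular bad_alpha good_below.
(* [C] is itself one of the classes intersected in the hull, so only the copies of [Cspace alpha]
   need checking. *)
move=> Y; apply=> // Z ZC.
have CC := minimal_bad_family_Cspace bad_alpha good_below hC CX.
case: hC => -[isoC _] _; apply: isoC CC.
by case: ZC => u [v [uc vc uv vu]]; exists v, u.
Qed.
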